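(* Let $N$ be a positive integer, let $\alpha=(\alpha_n : n\in\mathbb{Z})$ and $\beta=(\beta_n : n\in\mathbb{Z})$ be real $N$-periodic sequences with $\alpha_n>0$ for all $n$, and let $\tilde a=(\tilde a_k : k\ge 0)$ be an arbitrary sequence of positive numbers. Assume that $$\prod_{i=1}^{N}\begin{pmatrix}0&1\\-\frac{\alpha_{i-1}}{\alpha_i}&-\frac{\beta_i}{\alpha_i}\end{pmatrix}=\gamma\,\mathrm{Id}\quad\text{for some }|\gamma|=1.$$ Put $$a_{kN+i}=\alpha_i\tilde a_k,\qquad b_{kN+i}=\beta_i\tilde a_k\qquad(i=0,1,\dots,N-1;\ k\ge 0).$$ Then the Jacobi operator $A$ associated with the sequences $(a_n:n\ge0)$ and $(b_n:n\ge0)$ is self-adjoint and $0\notin\sigma_{\mathrm p}(A)$.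
   Context: For matrices, $\prod_{k=n_0}^{n_1}C_k=C_{n_1}C_{n_1-1}\cdots C_{n_0}$. For sequences $a_n>0$, $b_n\in\mathbb{R}$ ($n\ge 0$), let $\mathcal{A}$ be the infinite symmetric tridiagonal matrix with diagonal $b_0,b_1,b_2,\dots$ and off-diagonal entries $a_0,a_1,a_2,\dots$ (so $(\mathcal{A}x)_n=a_{n-1}x_{n-1}+b_nx_n+a_nx_{n+1}$ for $n\ge1$ and $(\mathcal{A}x)_0=b_0x_0+a_0x_1$). The Jacobi operator $A$ on $\ell^2=\ell^2(\mathbb{N})$, $\mathbb{N}=\{0,1,2,\dots\}$, is the restriction of $\mathcal{A}$ to the maximal domain $\mathrm{Dom}(A)=\{x\in\ell^2:\mathcal{A}x\in\ell^2\}$. $\sigma_{\mathrm p}(A)$ denotes the point spectrum (set of eigenvalues) of $A$. *)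

(* Defs.v *)
From mathcomp Require Import all_boot all_order all_algebra.
From mathcomp Require Export complex.
From mathcomp Require Import all_classical all_reals all_analysis.

Set Implicit Arguments.
Unset Strict Implicit.
Unset Printing Implicit Defensive.

Import Order.TTheory GRing.Theory Num.Theory numFieldNormedType.Exports.
Import ComplexField.Normc.

Local Open Scope classical_set_scope.
Local Open Scope ring_scope.
Local Open Scope complex_scope.

(* ell^2 is the complex Hilbert space of square-summable sequences over nat;
   [normc : R[i] -> R] is the complex modulus. *)
Definition ell2 (R : realType) : set (nat -> R[i]) :=
  [set x | cvgn (series (fun n => normc (x n) ^+ 2))].

Definition ell2_norm (R : realType) (x : nat -> R[i]) : R :=
  Num.sqrt (limn (series (fun n => normc (x n) ^+ 2))).

(* The alias [R[i]^o] is what carries the norm topology of R[i]. The series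
   converges (absolutely) when x and y are in ell^2; elsewhere the value is
   irrelevant. *)
Definition ell2_inner (R : realType) (x y : nat -> R[i]) : R[i] :=
  limn (series (fun n => x n * (y n)^*%C : R[i]^o)).

(* A possibly unbounded operator in ell^2; the values of [op_app] outside
   [op_dom] are junk and are never inspected. *)
Record operator (R : realType) := Operator {
  op_dom : set (nat -> R[i]);
  op_app : (nat -> R[i]) -> (nat -> R[i])
}.

Definition op_graph (R : realType) (T : operator R) :
    set ((nat -> R[i]) * (nat -> R[i])) :=
  [set p | op_dom T p.1 /\ p.2 = op_app T p.1].

Definition densely_defined (R : realType) (T : operator R) : Prop :=
  op_dom T `<=` ell2 (R := R) /\
  forall x, ell2 x -> forall e : R, 0 < e ->
    exists2 y, op_dom T y & ell2_norm (fun n => x n - y n) < e.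

(* The graph of T^*: y is in Dom(T^* ) with T^* y = z when <T x, y> = <x, z>
   for all x in Dom(T). When T is densely defined, z is unique. *)
Definition adjoint_graph (R : realType) (T : operator R) :
    set ((nat -> R[i]) * (nat -> R[i])) :=
  [set p | [/\ ell2 p.1, ell2 p.2 &
    forall x, op_dom T x -> ell2_inner (op_app T x) p.1 = ell2_inner x p.2]].

Definition self_adjoint (R : realType) (T : operator R) : Prop :=
  densely_defined T /\ adjoint_graph T = op_graph T.

Definition point_spectrum (R : realType) (T : operator R) : set R[i] :=
  [set l | exists x, [/\ op_dom T x, x <> (fun=> 0) &
                         op_app T x = (fun n => l * x n)]].

Definition jacobi_matrix (R : realType) (a b : nat -> R)
    (x : nat -> R[i]) (n : nat) : R[i] :=
  if n is m.+1 then
    (a m)%:C * x m + (b m.+1)%:C * x m.+1 + (a m.+1)%:C * x m.+2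
  else (b 0%N)%:C * x 0%N + (a 0%N)%:C * x 1%N.

(* The restriction of the formal matrix action to its maximal domain. *)
Definition jacobi_operator (R : realType) (a b : nat -> R) : operator R :=
  {| op_dom := [set x | ell2 x /\ ell2 (jacobi_matrix a b x)];
     op_app := jacobi_matrix a b |}.

Definition seq_periodic (R : realType) (N : nat) (u : int -> R) : Prop :=
  forall n : int, u (n + N%:Z) = u n.

Definition transfer_mx (R : realType) (alpha beta : int -> R) (i : nat) :
    'M[R]_2 :=
  \matrix_(r < 2, c < 2)
    if r == ord0 then (if c == ord0 then 0 else 1)
    else (if c == ord0 then - (alpha (i%:Z - 1) / alpha i%:Z)
          else - (beta i%:Z / alpha i%:Z)).

(* The factors are multiplied in decreasing order of the index:
   C n1 * C (n1 - 1) * ... * C n0. *)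
Definition rev_prod_mx (R : realType) (C : nat -> 'M[R]_2) (n0 n1 : nat) :
    'M[R]_2 :=
  \prod_(k <- rev (index_iota n0 n1.+1)) C k.

(* Main.v *)
Require Import Defs.
From mathcomp Require Import all_boot all_order all_algebra.
From mathcomp Require Import all_classical all_reals all_analysis.
From mathcomp Require Import ring lra.

(** Let J be the tridiagonal matrix with coefficients a and b. Everything
    follows from one explicit real solution p of J p = 0.

    Start with the periodic coefficients alpha and beta and solve the recurrence
    with p_0 = 1 and beta_0 p_0 + alpha_0 p_1 = 0. Since the product of the
    transfer matrices over a period is gamma Id, p_(n+N) = gamma p_n. Then
    beta_N p_N + alpha_N p_(N+1) is gamma times the initial condition, hence 0,
    and the recurrence at the end of the period leaves alpha_(N-1) p_(N-1) = 0.
    So p vanishes at the last site of each block: the weights of two adjacent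
    blocks never interact, and the same p solves J p = 0 for every choice of
    block weights ([jacobi_null_seq]). As |gamma| = 1, |p_(kN)| = 1 and p is not
    square summable ([null_seq_not_ell2]).

    A solution of J x = 0 is determined by x_0, so it is x_0 p, which is in ell^2
    only if x_0 = 0: this excludes the eigenvalue 0.

    A single solution outside ell^2 also makes the maximal operator self-adjoint
    ([jacobi_self_adjoint]). Testing against the coordinate vectors shows that
    the adjoint is a restriction of J to the maximal domain. For the converse,
    Green's formula writes <J x, y> - <x, J y> as the limit of the Wronskians
    W_n(x, conj y), and it must be seen that this limit is 0. The identity
      p_n W_n(x, y) = y_n W_n(x, p) - x_n W_n(y, p)
    and Green's formula W_n(x, p) = sum_(k <= n) (J x)_k p_k give, by the
    Cauchy-Schwarz inequality and with P_n = sum_(k <= n) p_k^2,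
      |W_n(x, y)|^2 p_n^2 / P_n
        <= 2 (||J x||^2 |y_n|^2 + ||J y||^2 |x_n|^2).
    The right-hand side is summable. By the Abel-Dini theorem p_n^2 / P_n is
    not, because P_n tends to infinity; so W_n cannot stay away from 0. *)

Set Implicit Arguments.
Unset Strict Implicit.
Unset Printing Implicit Defensive.

Import Order.TTheory GRing.Theory Num.Theory numFieldNormedType.Exports.
Import ComplexField.Normc.

Local Open Scope classical_set_scope.
Local Open Scope ring_scope.
Local Open Scope complex_scope.

(** * Squared modulus and finite sums *)

Lemma sqr_normcE (R : realType) (z : R[i]) :
  normc z ^+ 2 = complex.Re z ^+ 2 + complex.Im z ^+ 2.
Proof. by case: z => u v /=; rewrite sqr_sqrtr // addr_ge0 ?sqr_ge0. Qed.

Lemma sqr_normc_ge0 (R : realType) (z : R[i]) : 0 <= normc z ^+ 2.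
Proof. exact: sqr_ge0. Qed.

Lemma sqr_normcM (R : realType) (z w : R[i]) :
  normc (z * w) ^+ 2 = normc z ^+ 2 * normc w ^+ 2.
Proof. by rewrite normcM exprMn. Qed.

Lemma sqr_normc_real (R : realType) (r : R) : normc r%:C ^+ 2 = r ^+ 2.
Proof. by rewrite sqr_normcE /= expr0n addr0. Qed.

Lemma sqr_normcJ (R : realType) (z : R[i]) : normc z^*%C ^+ 2 = normc z ^+ 2.
Proof. by rewrite !sqr_normcE; case: z => u v /=; rewrite sqrrN. Qed.

Lemma sqr_normcB_le (R : realType) (z w : R[i]) :
  normc (z - w) ^+ 2 <= 2 * (normc z ^+ 2 + normc w ^+ 2).
Proof.
rewrite !sqr_normcE; case: z w => [u v] [s t] /=.
have := sqr_ge0 (u + s); have := sqr_ge0 (v + t); lra.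
Qed.

Lemma Cauchy_Schwarz_sum (R : realType) (u v : nat -> R) n :
  (\sum_(0 <= k < n) u k * v k) ^+ 2 <=
  (\sum_(0 <= k < n) u k ^+ 2) * (\sum_(0 <= k < n) v k ^+ 2).
Proof.
have sq_ge0 (w : nat -> R) m : 0 <= \sum_(0 <= k < m) w k ^+ 2.
  by apply: sumr_ge0 => k _; exact: sqr_ge0.
elim: n => [|n IHn]; first by rewrite !big_geq // expr0n mul0r.
rewrite !big_nat_recr //=.
move: (sq_ge0 u n) (sq_ge0 v n) IHn.
set S := \sum_(0 <= k < n) u k * v k.
set U := \sum_(0 <= k < n) u k ^+ 2.
set V := \sum_(0 <= k < n) v k ^+ 2.
move=> U_ge0 V_ge0 leSUV; move: (u n) (v n) => s t.
(* The induction step needs only the bound on the mixed term. *)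
suff cross : 2 * S * (s * t) <= U * t ^+ 2 + V * s ^+ 2 by nra.
move: U_ge0; rewrite le_eqVlt => /predU1P[U0|U_gt0].
  have S0 : S = 0.
    by apply/eqP; rewrite -sqrf_eq0 eq_le sqr_ge0 (le_trans leSUV) // -U0 mul0r.
  by rewrite S0 -U0; nra.
(* U (U t^2 + V s^2 - 2 S s t) >= (U t - S s)^2, since U V >= S^2. *)
rewrite -subr_ge0 -(pmulr_rge0 _ U_gt0).
have := sqr_ge0 (U * t - S * s); have := sqr_ge0 s; nra.
Qed.

(** The weights are real, so the real and imaginary parts of the sum separate
    and the real Cauchy-Schwarz inequality applies to each. *)
Lemma sqr_normc_sum_le (R : realType) (x : nat -> R[i]) (p : nat -> R) n :
  normc (\sum_(0 <= k < n) x k * (p k)%:C) ^+ 2 <=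
  (\sum_(0 <= k < n) normc (x k) ^+ 2) * (\sum_(0 <= k < n) p k ^+ 2).
Proof.
have -> : \sum_(0 <= k < n) x k * (p k)%:C =
    ((\sum_(0 <= k < n) complex.Re (x k) * p k)
     +i* (\sum_(0 <= k < n) complex.Im (x k) * p k))%C.
  elim: n => [|n IHn]; first by rewrite !big_geq.
  rewrite !big_nat_recr //= IHn; case: (x n) => u v.
  by apply/eqP; rewrite eq_complex /= !mulr0 subr0 add0r !eqxx.
rewrite sqr_normcE /=.
under [X in _ <= X * _]eq_bigr do rewrite sqr_normcE.
by rewrite big_split /= mulrDl lerD // Cauchy_Schwarz_sum.
Qed.

(** * Square-summable sequences *)

Lemma ell2_sum_le (R : realType) (x : nat -> R[i]) : ell2 x ->
  forall n, \sum_(0 <= k < n) normc (x k) ^+ 2 <=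
            limn (series (fun k => normc (x k) ^+ 2)).
Proof.
move=> xl2 n; apply: (nondecreasing_cvgn_le _ xl2 n).
by apply: nondecreasing_series => k _ _; exact: sqr_normc_ge0.
Qed.

Lemma series_finite_support (V : zmodType) (u : nat -> V) m :
  (forall n, (m <= n)%N -> u n = 0) ->
  forall n, (m <= n)%N ->
    \sum_(0 <= k < n) u k = \sum_(0 <= k < m) u k.
Proof.
move=> u0 n mn; rewrite (big_cat_nat (leq0n m) mn) //=.
rewrite [X in _ + X]big1_seq ?addr0 // => k.
by rewrite mem_index_iota => /andP[_ /andP[mk _]]; exact: u0.
Qed.

Lemma ell2_finite_support (R : realType) (x : nat -> R[i]) m :
  (forall n, (m <= n)%N -> x n = 0) -> ell2 x.
Proof.
move=> x0; apply/cvg_ex.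
exists (\sum_(0 <= k < m) normc (x k) ^+ 2); apply: cvg_near_cst.
near=> n; apply: series_finite_support; last by near: n; exists m.
by move=> k mk; rewrite x0 // normc0 expr0n.
Unshelve. all: by end_near. Qed.

Lemma ell2_inner_finite (R : realType) (x y : nat -> R[i]) m :
  (forall n, (m <= n)%N -> x n = 0) ->
  ell2_inner x y = \sum_(0 <= k < m) x k * (y k)^*%C.
Proof.
move=> x0; apply: (@lim_near_cst R[i]^o); first exact: norm_hausdorff.
near=> n; apply: series_finite_support; last by near: n; exists m.
by move=> k mk; rewrite x0 // mul0r.
Unshelve. all: by end_near. Qed.

(** Brings componentwise limits into the norm topology in which [ell2_inner]
    takes its limit. *)
Lemma cvg_complex (R : realType) (z : nat -> R[i]) (u v : R) :
  complex.Re (z n) @[n --> \oo] --> u -> complex.Im (z n) @[n --> \oo] --> v ->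
  (z n : R[i]^o) @[n --> \oo] --> ((u +i* v)%C : R[i]^o).
Proof.
move=> /cvgrPdist_lt zu /cvgrPdist_lt zv; apply/cvgrPdist_lt => e.
case: e => e f; rewrite ltcE /= => /andP[/eqP -> e_gt0].
(* A positive element of R[i] is a positive real, here e. *)
have e2_gt0 : 0 < e / 2 by rewrite divr_gt0.
near=> n.
rewrite normc_def ltcE /= eqxx /=.
have un : `|u - complex.Re (z n)| < e / 2 by near: n; exact: zu.
have vn : `|v - complex.Im (z n)| < e / 2 by near: n; exact: zv.
rewrite -(ger0_norm (ltW e_gt0)) -sqrtr_sqr ltr_sqrt ?exprn_gt0 //.
move: un vn; rewrite !ltr_norml => /andP[u1 u2] /andP[v1 v2].
case: (z n) u1 u2 v1 v2 => s t /= *; nra.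
Unshelve. all: by end_near. Qed.

(** The terms are dominated by |x_k|^2 + |y_k|^2. The limits are
    stated in R because the Wronskian argument takes place there. *)
Lemma ell2_inner_cvg (R : realType) (x y : nat -> R[i]) : ell2 x -> ell2 y ->
  complex.Re (\sum_(0 <= k < n) x k * (y k)^*%C) @[n --> \oo]
    --> complex.Re (ell2_inner x y) /\
  complex.Im (\sum_(0 <= k < n) x k * (y k)^*%C) @[n --> \oo]
    --> complex.Im (ell2_inner x y).
Proof.
move=> xl2 yl2.
have dom (f : R[i] -> R) : (forall z, `|f z| <= normc z) ->
    cvgn (series (fun k => f (x k * (y k)^*%C))).
  move=> le_f; apply: normed_cvg.
  apply: (series_le_cvg _ _ _ (is_cvg_seriesD xl2 yl2)).
  - by move=> n; exact: normr_ge0.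
  - by move=> n; rewrite addr_ge0 ?sqr_normc_ge0.
  move=> n; apply: le_trans (le_f _) _; rewrite normcM.
  have -> : normc (y n)^*%C = normc (y n) by case: (y n) => u v /=; rewrite sqrrN.
  have AMGM (s t : R) : s * t <= s ^+ 2 + t ^+ 2.
    have := sqr_ge0 (s - t); have := sqr_ge0 s; have := sqr_ge0 t; lra.
  exact: AMGM.
have sumRe n : complex.Re (\sum_(0 <= k < n) x k * (y k)^*%C) =
    series (fun k => complex.Re (x k * (y k)^*%C)) n.
  exact: (raddf_sum (@complex.Re R : Rcomplex R -> R)).
have sumIm n : complex.Im (\sum_(0 <= k < n) x k * (y k)^*%C) =
    series (fun k => complex.Im (x k * (y k)^*%C)) n.
  exact: (raddf_sum (@complex.Im R : Rcomplex R -> R)).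
have le_part (s t : R) : `|s| <= Num.sqrt (s ^+ 2 + t ^+ 2).
  by rewrite -sqrtr_sqr ler_wsqrtr // lerDl sqr_ge0.
have cRe : cvgn (series (fun k => complex.Re (x k * (y k)^*%C))).
  by apply: dom => -[s t] /=; exact: le_part.
have cIm : cvgn (series (fun k => complex.Im (x k * (y k)^*%C))).
  by apply: dom => -[s t] /=; rewrite addrC le_part.
have hRe : complex.Re (\sum_(0 <= k < n) x k * (y k)^*%C) @[n --> \oo]
    --> limn (series (fun k => complex.Re (x k * (y k)^*%C))).
  by under eq_fun do rewrite sumRe.
have hIm : complex.Im (\sum_(0 <= k < n) x k * (y k)^*%C) @[n --> \oo]
    --> limn (series (fun k => complex.Im (x k * (y k)^*%C))).
  by under eq_fun do rewrite sumIm.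
by rewrite /ell2_inner (@cvg_lim R[i]^o _ _ _ _ _ _ (cvg_complex hRe hIm)).
Qed.

(** * Jacobi matrices: Green's formula and the kernel *)

Definition wronskian (R : realType) (a : nat -> R) (x y : nat -> R[i]) n : R[i] :=
  (a n)%:C * (x n.+1 * y n - x n * y n.+1).

(** The terms with b cancel and those with a telescope. *)
Lemma jacobi_Green (R : realType) (a b : nat -> R) (x y : nat -> R[i]) n :
  \sum_(0 <= k < n.+1)
     (jacobi_matrix a b x k * y k - x k * jacobi_matrix a b y k) =
  wronskian a x y n.
Proof.
elim: n => [|n IHn]; first by rewrite big_nat1 /wronskian /=; ring.
by rewrite big_nat_recr //= IHn /wronskian; ring.
Qed.

Lemma jacobi_matrixJ (R : realType) (a b : nat -> R) (x : nat -> R[i]) n :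
  jacobi_matrix a b (fun k => (x k)^*%C) n = (jacobi_matrix a b x n)^*%C.
Proof. by case: n => [|n] /=; rewrite !rmorphD !rmorphM /= !oppr0. Qed.

(** The three-term relation between 2 x 2 minors. It bounds the
    Wronskian of x and y by their Wronskians with a solution z, which Green's
    formula expresses by J x and J y. *)
Lemma wronskian_Plucker (R : realType) (a : nat -> R) (x y z : nat -> R[i]) n :
  wronskian a x y n * z n = y n * wronskian a x z n - x n * wronskian a y z n.
Proof. by rewrite /wronskian; ring. Qed.

(** The rows of J x = 0 give x_1, x_2, ... successively in terms of x_0, as no
    a_n vanishes. *)
Lemma jacobi_kernel (R : realType) (a b : nat -> R) (x p : nat -> R[i]) :
  (forall n, a n != 0) -> p 0%N = 1 ->
  (forall n, jacobi_matrix a b p n = 0) ->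
  (forall n, jacobi_matrix a b x n = 0) ->
  forall n, x n = x 0%N * p n.
Proof.
move=> a0 p0 Jp Jx.
pose d n := x n - x 0%N * p n.
have Jd n : jacobi_matrix a b d n = 0.
  have -> : jacobi_matrix a b d n =
      jacobi_matrix a b x n - x 0%N * jacobi_matrix a b p n.
    by case: n => [|n]; rewrite /d /=; ring.
  by rewrite Jx Jp mulr0 subr0.
have aC0 n : (a n)%:C != 0 :> R[i] by rewrite fmorph_eq0.
suff d0 n : d n = 0 /\ d n.+1 = 0.
  by move=> n; apply/eqP; rewrite -subr_eq0; apply/eqP; case: (d0 n).
elim: n => [|n [dn dSn]]; last first.
  split=> //; have /eqP := Jd n.+1.
  by rewrite /= dn dSn !mulr0 !add0r mulf_eq0 (negbTE (aC0 _)) /= => /eqP.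
have d0 : d 0%N = 0 by rewrite /d p0 mulr1 subrr.
split=> //; have /eqP := Jd 0%N.
by rewrite /= d0 mulr0 add0r mulf_eq0 (negbTE (aC0 _)) /= => /eqP.
Qed.

(** * Vanishing of the Wronskian at infinity *)

(** Let P n be the sum of q over k < n. If l > 0, choose M such that w > l / 2
    from M on and such that every partial sum of the given series taken from M on
    is at most l / 4. As P k.+1 <= P n for k < n, this gives
    (l / 2) (P n - P M) <= (l / 4) P n, that is P n <= 2 P M, and the series of q
    would be bounded. With w = 1 this is the Abel-Dini theorem. *)
Lemma Abel_Dini_limit (R : realType) (w q : nat -> R) (l : R) :
  (forall n, 0 <= q n) -> 0 < q 0%N -> ~ cvgn (series q) ->
  cvgn (series (fun n => w n * q n / \sum_(0 <= k < n.+1) q k)) ->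
  w n @[n --> \oo] --> l -> l <= 0.
Proof.
move=> q_ge0 q0_gt0 divq cvgS wl; rewrite leNgt; apply/negP => l_gt0.
apply: divq.
pose P n := \sum_(0 <= k < n) q k.
have P_mono m n : (m <= n)%N -> P m <= P n.
  by move=> mn; rewrite /P (big_cat_nat (leq0n m) mn) /= lerDl sumr_ge0.
have P_gt0 n : 0 < P n.+1.
  by apply: lt_le_trans (P_mono 1%N _ _) => //; rewrite /P big_nat1.
pose S := series (fun n => w n * q n / P n.+1).
have l8_gt0 : 0 < l / 8 by rewrite divr_gt0.
have l2_gt0 : 0 < l / 2 by rewrite divr_gt0.
have [M _ HM] : \forall n \near \oo, l / 2 < w n /\ `|limn S - S n| < l / 8.
  near=> n; split; last by near: n; move/cvgrPdist_lt: cvgS; apply.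
  have : `|l - w n| < l / 2 by near: n; move/cvgrPdist_lt: wl; apply.
  by rewrite ltr_norml => /andP[_ ?]; lra.
have tail n : (M <= n)%N ->
    l / 2 * (P n - P M) <= P n * (l / 4).
  move=> Mn.
  have P_ge0 : 0 <= P n by apply: sumr_ge0.
  have : S n - S M <= l / 4.
    have [_] := HM n Mn; have [_] := HM M (leqnn M).
    by rewrite !ltr_norml => /andP[? ?] /andP[? ?]; lra.
  move=> /(ler_wpM2l P_ge0); apply: le_trans.
  rewrite /S /series /= /P (big_cat_nat (leq0n M) Mn) /=.
  rewrite [in leRHS](big_cat_nat (leq0n M) Mn) /=.
  rewrite -!(addrAC _ (- _)) !subrr !add0r.
  rewrite -(big_cat_nat (leq0n M) Mn) /= -/(P n) !mulr_sumr.
  rewrite !big_nat; apply: ler_sum => k /andP[Mk kn].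
  have [wk _] := HM k Mk.
  have Pk := P_gt0 k; have PkPn := P_mono _ _ kn.
  rewrite -/(P k.+1) mulrA ler_pdivlMr //.
  apply: (@le_trans _ _ (l / 2 * q k * P n)).
    by rewrite ler_wpM2l // mulr_ge0 // ltW.
  by rewrite mulrC ler_wpM2l // ler_wpM2r // ltW.
apply: nondecreasing_is_cvgn; first by move=> m n; exact: P_mono.
exists (2 * P M) => _ [n _ <-].
have PM_ge0 : 0 <= P M by apply: sumr_ge0.
suff: P n <= 2 * P M by [].
case: (leqP M n) => [Mn|/ltnW nM]; last by have := P_mono _ _ nM; lra.
by rewrite -(ler_pM2l l_gt0); have := tail n Mn; lra.
Unshelve. all: by end_near. Qed.

(** The limit-point argument: [Abel_Dini_limit] for the squared moduli of the
    Wronskians and the divergent series of the p_n^2. *)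
Lemma wronskian_limit0 (R : realType) (a b p : nat -> R) (x y : nat -> R[i])
    (l : R[i]) :
  p 0%N = 1 -> ~ cvgn (series (fun n => p n ^+ 2)) ->
  (forall n, jacobi_matrix a b (fun k => (p k)%:C) n = 0) ->
  ell2 x -> ell2 (jacobi_matrix a b x) ->
  ell2 y -> ell2 (jacobi_matrix a b y) ->
  complex.Re (wronskian a x y n) @[n --> \oo] --> complex.Re l ->
  complex.Im (wronskian a x y n) @[n --> \oo] --> complex.Im l ->
  l = 0.
Proof.
move=> p0 divp Jp xl2 Jxl2 yl2 Jyl2 cRe cIm.
pose P n := \sum_(0 <= k < n.+1) p k ^+ 2.
have P_gt0 n : 0 < P n.
  rewrite /P big_nat_recl //= p0 expr1n ltr_pwDl // sumr_ge0 // => k _.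
  exact: sqr_ge0.
pose A u := limn (series (fun k => normc (jacobi_matrix a b u k) ^+ 2)).
have Wp (u : nat -> R[i]) n : ell2 (jacobi_matrix a b u) ->
    normc (wronskian a u (fun k => (p k)%:C) n) ^+ 2 <=
      A u * P n.
  move=> Jul2; rewrite -(jacobi_Green a b).
  under eq_bigr do rewrite Jp mulr0 subr0.
  apply: le_trans (sqr_normc_sum_le _ _ _) _.
  by rewrite ler_wpM2r ?(ltW (P_gt0 _)) ?ell2_sum_le.
have bound n : normc (wronskian a x y n) ^+ 2 * p n ^+ 2 / P n <=
    2 * A x * normc (y n) ^+ 2 + 2 * A y * normc (x n) ^+ 2.
  rewrite ler_pdivrMr // -(sqr_normc_real (p n)) -sqr_normcM.
  rewrite (wronskian_Plucker a x y (fun k => (p k)%:C)).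
  apply: le_trans (sqr_normcB_le _ _) _.
  rewrite (sqr_normcM (y n)) (sqr_normcM (x n)).
  have combine (s t u v X Y Q : R) : 0 <= s -> 0 <= t ->
      u <= X * Q -> v <= Y * Q ->
      2 * (s * u + t * v) <= (2 * X * s + 2 * Y * t) * Q.
    by move=> s0 t0 /(ler_wpM2l s0) us /(ler_wpM2l t0) vt; lra.
  by apply: combine; rewrite ?sqr_normc_ge0 //; exact: Wp.
have cN : normc (wronskian a x y n) ^+ 2 @[n --> \oo] --> normc l ^+ 2.
  under eq_fun do rewrite sqr_normcE.
  by rewrite sqr_normcE !expr2; apply: cvgD; apply: cvgM.
have : normc l ^+ 2 <= 0.
  apply: (@Abel_Dini_limit _ _ (fun n => p n ^+ 2)) cN => //.
  - by move=> n; exact: sqr_ge0.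
  - by rewrite p0 expr1n.
  have A_ge0 u : ell2 (jacobi_matrix a b u) -> 0 <= A u.
    by move=> /ell2_sum_le/(_ 0%N); rewrite big_geq.
  apply: (series_le_cvg _ _ bound).
  - by move=> n; apply: divr_ge0 (ltW (P_gt0 n)); rewrite mulr_ge0 ?sqr_ge0.
  - move=> n; apply: addr_ge0; apply: mulr_ge0; rewrite ?sqr_ge0 //.
    + by apply: mulr_ge0 => //; exact: A_ge0.
    + by apply: mulr_ge0 => //; exact: A_ge0.
  apply: is_cvg_seriesD; exact: is_cvg_seriesZ.
move=> l_le0; apply: eq0_normc; apply/eqP.
by rewrite -sqrf_eq0 eq_le l_le0 sqr_normc_ge0.
Qed.

(** * Self-adjointness from a solution outside ell^2 *)

Lemma jacobi_finite_support (R : realType) (a b : nat -> R) (x : nat -> R[i]) m :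
  (forall n, (m <= n)%N -> x n = 0) ->
  forall n, (m.+1 <= n)%N -> jacobi_matrix a b x n = 0.
Proof.
move=> x0 [|n] //; rewrite ltnS => mn.
by rewrite /= !x0 ?mulr0 ?addr0 // !leqW.
Qed.

(** Truncations of x lie in the domain and converge to x. *)
Lemma jacobi_densely_defined (R : realType) (a b : nat -> R) :
  densely_defined (jacobi_operator a b).
Proof.
split=> [x []//|x xl2 e e_gt0].
have [m _ Hm] : \forall m \near \oo,
    `|limn (series (fun n => normc (x n) ^+ 2))
      - series (fun n => normc (x n) ^+ 2) m| < e ^+ 2.
  by move/cvgrPdist_lt: xl2; apply; rewrite exprn_gt0.
pose y n := if (n < m)%N then x n else 0.
have y0 n : (m <= n)%N -> y n = 0 by rewrite /y leqNgt => /negbTE ->.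
exists y.
  split; first exact: (ell2_finite_support y0).
  exact: (ell2_finite_support (jacobi_finite_support a b y0)).
rewrite /ell2_norm -(ger0_norm (ltW e_gt0)) -sqrtr_sqr ltr_sqrt ?exprn_gt0 //.
apply: le_lt_trans (le_lt_trans (ler_norm _) (Hm m (leqnn m))).
have tailE n : (m <= n)%N -> series (fun n => normc (x n - y n) ^+ 2) n =
    series (fun n => normc (x n) ^+ 2) n - series (fun n => normc (x n) ^+ 2) m.
  move=> mn; rewrite /series /= !(big_cat_nat (leq0n m) mn) /=.
  rewrite [X in X + _]big_nat big1 ?add0r.
    rewrite [RHS]addrAC subrr add0r; apply: eq_big_nat => k /andP[mk _].
    by rewrite y0 // subr0.
  by move=> k /andP[_ km]; rewrite /y km subrr normc0 expr0n.
suff : series (fun n => normc (x n - y n) ^+ 2) n @[n --> \oo] -->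
    limn (series (fun n => normc (x n) ^+ 2))
    - series (fun n => normc (x n) ^+ 2) m.
  by move=> /cvg_lim ->.
apply: (@cvg_trans _ ((series (fun n => normc (x n) ^+ 2) n
    - series (fun n => normc (x n) ^+ 2) m) @[n --> \oo])).
  by apply: near_eq_cvg; near=> n; rewrite tailE //; near: n; exists m.
by apply: cvgB => //; exact: cvg_cst.
Unshelve. all: by end_near. Qed.

(** The coordinate vector at n is in the domain. Green's formula beyond its
    support has no boundary term, so testing the adjoint relation on it gives
    z_n = (J y)_n. *)
Lemma jacobi_adjoint_sub (R : realType) (a b : nat -> R) :
  adjoint_graph (jacobi_operator a b) `<=` op_graph (jacobi_operator a b).
Proof.
move=> [y z] /= [yl2 zl2 adj].
suff zE : z = jacobi_matrix a b y by split=> //=; split=> //; rewrite -zE.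
apply/funext => n.
pose x k : R[i] := (k == n)%:R.
have x0 k : (n.+1 <= k)%N -> x k = 0 by rewrite /x => nk; rewrite gtn_eqF.
have Jx0 := jacobi_finite_support a b x0.
have x0' k : (n.+2 <= k)%N -> x k = 0 by move=> nk; rewrite x0 // ltnW.
have pick (u : nat -> R[i]) : \sum_(0 <= k < n.+2) x k * u k = u n.
  rewrite (bigD1_seq n) ?mem_index_iota ?iota_uniq //=.
  rewrite /x eqxx mul1r big1 ?addr0 // => k kn.
  by rewrite (negbTE kn) mul0r.
have := adj x (conj (ell2_finite_support x0) (ell2_finite_support Jx0)).
rewrite (ell2_inner_finite _ Jx0) (ell2_inner_finite _ x0') pick.
have := jacobi_Green a b x (fun k => (y k)^*%C) n.+1.
rewrite /wronskian (x0 n.+1) // (x0 n.+2) // !mul0r subrr mulr0 sumrB => /eqP.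
rewrite subr_eq0 => /eqP -> /=; rewrite pick jacobi_matrixJ => /(congr1 conjc).
by rewrite !conjcK.
Qed.

(** The difference of the two inner products is the limit of the Wronskians of
    x and conj y, since the coefficients of J are real. *)
Theorem jacobi_self_adjoint (R : realType) (a b p : nat -> R) :
  p 0%N = 1 -> ~ cvgn (series (fun n => p n ^+ 2)) ->
  (forall n, jacobi_matrix a b (fun k => (p k)%:C) n = 0) ->
  self_adjoint (jacobi_operator a b).
Proof.
move=> p0 divp Jp; split; first exact: jacobi_densely_defined.
apply/seteqP; split; first exact: jacobi_adjoint_sub.
move=> [y z] /= [[yl2 Jyl2] /= ->]; split=> // x [xl2 Jxl2] /=.
have [r1 i1] := ell2_inner_cvg Jxl2 yl2.
have [r2 i2] := ell2_inner_cvg xl2 Jyl2.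
pose yc k := (y k)^*%C.
have ell2J (u : nat -> R[i]) : ell2 u -> ell2 (fun k => (u k)^*%C).
  by rewrite /ell2 /=; under [in X in _ -> X]eq_fun do rewrite sqr_normcJ.
have Jyc : jacobi_matrix a b yc = fun k => (jacobi_matrix a b y k)^*%C.
  by apply/funext => k; rewrite -jacobi_matrixJ.
have WE n : wronskian a x yc n =
    \sum_(0 <= k < n.+1) jacobi_matrix a b x k * (y k)^*%C
    - \sum_(0 <= k < n.+1) x k * (jacobi_matrix a b y k)^*%C.
  by rewrite -(jacobi_Green a b) sumrB Jyc.
apply/eqP; rewrite -subr_eq0; apply/eqP.
apply: (@wronskian_limit0 _ a b p x yc _ p0 divp Jp xl2 Jxl2).
- exact: ell2J.
- by rewrite Jyc; exact: ell2J.
- under eq_fun do rewrite WE (raddfB (@complex.Re R : Rcomplex R -> R)).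
  rewrite (raddfB (@complex.Re R : Rcomplex R -> R)).
  by apply: cvgB; rewrite (cvg_shiftS (fun n => complex.Re _)).
- under eq_fun do rewrite WE (raddfB (@complex.Im R : Rcomplex R -> R)).
  rewrite (raddfB (@complex.Im R : Rcomplex R -> R)).
  by apply: cvgB; rewrite (cvg_shiftS (fun n => complex.Im _)).
Qed.

Lemma zero_notin_point_spectrum (R : realType) (a b p : nat -> R) :
  (forall n, a n != 0) ->
  p 0%N = 1 -> ~ cvgn (series (fun n => p n ^+ 2)) ->
  (forall n, jacobi_matrix a b (fun k => (p k)%:C) n = 0) ->
  ~ point_spectrum (jacobi_operator a b) 0.
Proof.
move=> a0 p0 divp Jp [x [[xl2 _] x_neq0 /= Jx]].
have xE := jacobi_kernel (x := x) a0 (congr1 (real_complex R) p0) Jp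
  (fun n => etrans (congr1 (@^~ n) Jx) (mul0r _)).
have x0_neq0 : normc (x 0%N) ^+ 2 != 0.
  rewrite sqrf_eq0; apply/eqP => /eq0_normc x0.
  by apply: x_neq0; apply/funext => n; rewrite xE x0 mul0r.
apply: divp.
have -> : (fun n => p n ^+ 2) =
    (normc (x 0%N) ^+ 2)^-1 *: (fun n => normc (x n) ^+ 2).
  apply/funext => n; rewrite [RHS]/= -[RHS]/(_ * _) (xE n) sqr_normcM.
  by rewrite sqr_normc_real mulrA mulVf // mul1r.
exact: is_cvg_seriesZ.
Qed.

(** * The solution of the periodic recurrence *)

(** The vector (p_n, p_(n+1)), where p is the solution with p_0 = 1 and
    beta_0 p_0 + alpha_0 p_1 = 0. *)
Definition null_state (R : realType) (alpha beta : int -> R) n : 'cV[R]_2 :=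
  rev_prod_mx (transfer_mx alpha beta) 1 n *m
  \col_(r < 2) if r == ord0 then 1 else - (beta 0 / alpha 0).

Definition null_seq (R : realType) (alpha beta : int -> R) n : R :=
  null_state alpha beta n ord0 ord0.

Lemma null_stateS (R : realType) (alpha beta : int -> R) n :
  null_state alpha beta n.+1 =
  transfer_mx alpha beta n.+1 *m null_state alpha beta n.
Proof.
rewrite /null_state mulmxA; congr (_ *m _).
have iotaS : index_iota 1 n.+2 = rcons (index_iota 1 n.+1) n.+1.
  by rewrite /index_iota !subSS !subn0 -cats1 -(addn1 n) iotaD add1n addn1.
by rewrite /rev_prod_mx iotaS rev_rcons big_cons.
Qed.

Lemma transfer_mxE (R : realType) (alpha beta : int -> R) i (v : 'cV[R]_2) :
  (transfer_mx alpha beta i *m v) ord0 ord0 = v ord_max ord0 /\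
  (transfer_mx alpha beta i *m v) ord_max ord0 =
    - (alpha (i%:Z - 1) / alpha i%:Z) * v ord0 ord0
    - beta i%:Z / alpha i%:Z * v ord_max ord0.
Proof.
have lift1 : lift ord0 ord0 = ord_max :> 'I_2 by exact: val_inj.
rewrite !mxE !big_ord_recl !big_ord0 !mxE /= lift1 /=.
by split; [rewrite mul0r add0r mul1r addr0 | rewrite addr0 [X in _ + X]mulNr].
Qed.

Lemma null_seqS (R : realType) (alpha beta : int -> R) n :
  null_seq alpha beta n.+1 = null_state alpha beta n ord_max ord0.
Proof.
rewrite /null_seq null_stateS.
by case: (transfer_mxE alpha beta n.+1 (null_state alpha beta n)).
Qed.

Lemma null_state0 (R : realType) (alpha beta : int -> R) :
  null_state alpha beta 0 =
  \col_(r < 2) if r == ord0 then 1 else - (beta 0 / alpha 0).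
Proof. by rewrite /null_state /rev_prod_mx big_nil mul1mx. Qed.

Lemma null_seq0 (R : realType) (alpha beta : int -> R) :
  null_seq alpha beta 0 = 1.
Proof. by rewrite /null_seq null_state0 mxE. Qed.

Lemma null_seq_start (R : realType) (alpha beta : int -> R) :
  alpha 0 != 0 ->
  beta 0 * null_seq alpha beta 0 + alpha 0 * null_seq alpha beta 1 = 0.
Proof.
move=> al0; rewrite null_seqS null_seq0 null_state0 mxE /=.
by field.
Qed.

Lemma null_seq_rec (R : realType) (alpha beta : int -> R) n :
  alpha n.+1%:Z != 0 ->
  alpha n%:Z * null_seq alpha beta n + beta n.+1%:Z * null_seq alpha beta n.+1
  + alpha n.+1%:Z * null_seq alpha beta n.+2 = 0.
Proof.
move=> al0; rewrite (null_seqS _ _ n.+1) null_stateS.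
have [_ ->] := transfer_mxE alpha beta n.+1 (null_state alpha beta n).
rewrite -null_seqS -/(null_seq alpha beta n).
have -> : n.+1%:Z - 1 = n%:Z by rewrite -addn1 PoszD addrK.
by field.
Qed.

Lemma null_state_shift (R : realType) (N : nat) (alpha beta : int -> R)
    (gamma : R) :
  seq_periodic N alpha -> seq_periodic N beta ->
  rev_prod_mx (transfer_mx alpha beta) 1 N = gamma%:M ->
  forall n,
  null_state alpha beta (n + N) = gamma *: null_state alpha beta n.
Proof.
move=> alpha_per beta_per monodromy n; elim: n => [|n IHn].
  by rewrite add0n {1}/null_state monodromy mul_scalar_mx null_state0.
rewrite addSn !null_stateS IHn -scalemxAr; congr (_ *: (_ *m _)).
apply/matrixP => r c; rewrite !mxE -addSn PoszD addrAC.
by rewrite !alpha_per beta_per.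
Qed.

Lemma null_seq_block (R : realType) (N : nat) (alpha beta : int -> R)
    (gamma : R) :
  seq_periodic N alpha -> seq_periodic N beta ->
  rev_prod_mx (transfer_mx alpha beta) 1 N = gamma%:M ->
  forall k n,
  null_seq alpha beta (k * N + n) = gamma ^+ k * null_seq alpha beta n.
Proof.
move=> alpha_per beta_per monodromy k n.
elim: k => [|k IHk]; first by rewrite mul0n add0n mul1r.
have -> : (k.+1 * N + n = k * N + n + N)%N by rewrite mulSn -addnA addnC.
rewrite exprS -mulrA -IHk /null_seq.
by rewrite (null_state_shift alpha_per beta_per monodromy) mxE.
Qed.

(** After a period the initial condition holds again, up to the factor gamma, so
    that two of the three terms of the recurrence cancel and the third, a nonzero
    multiple of the last entry of the period, vanishes. *)
Lemma null_seq_block_end (R : realType) (N : nat) (alpha beta : int -> R)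
    (gamma : R) :
  seq_periodic N.+1 alpha -> seq_periodic N.+1 beta ->
  (forall n, 0 < alpha n) ->
  rev_prod_mx (transfer_mx alpha beta) 1 N.+1 = gamma%:M ->
  null_seq alpha beta N = 0.
Proof.
move=> alpha_per beta_per alpha_gt0 monodromy.
have rec := null_seq_rec (alpha := alpha) beta (n := N) (lt0r_neq0 (alpha_gt0 _)).
have blk := null_seq_block alpha_per beta_per monodromy 1.
have pN : null_seq alpha beta N.+1 = gamma * null_seq alpha beta 0.
  by have := blk 0%N; rewrite mul1n addn0 expr1.
have pN1 : null_seq alpha beta N.+2 = gamma * null_seq alpha beta 1.
  by have := blk 1%N; rewrite mul1n addn1 expr1.
have per (u : int -> R) : seq_periodic N.+1 u -> u N.+1%:Z = u 0.
  by move=> u_per; rewrite -[RHS]u_per add0r.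
have start := null_seq_start beta (lt0r_neq0 (alpha_gt0 0)).
move: rec; rewrite pN pN1 !per //.
rewrite (mulrCA (beta 0)) (mulrCA (alpha 0)).
rewrite -addrA -mulrDr start mulr0 addr0 => /eqP.
by rewrite mulf_eq0 gt_eqF //= => /eqP.
Qed.

(** Inside a block, and in the last two terms of the row that starts a block,
    the block weight is a common factor. The first term of such a row carries the
    weight of the preceding block, but there p is 0. *)
Lemma jacobi_null_seq (R : realType) (N : nat) (alpha beta : int -> R)
    (gamma : R) (ta a b : nat -> R) :
  (0 < N)%N ->
  seq_periodic N alpha -> seq_periodic N beta ->
  (forall n, 0 < alpha n) ->
  rev_prod_mx (transfer_mx alpha beta) 1 N = gamma%:M ->
  (forall k i, (i < N)%N -> a (k * N + i)%N = alpha i%:Z * ta k) ->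
  (forall k i, (i < N)%N -> b (k * N + i)%N = beta i%:Z * ta k) ->
  forall n, jacobi_matrix a b (fun k => (null_seq alpha beta k)%:C) n = 0.
Proof.
case: N => // N _ alpha_per beta_per alpha_gt0 monodromy ha hb.
set p := null_seq alpha beta.
have start : beta 0 * p 0%N + alpha 0 * p 1%N = 0.
  exact: null_seq_start (lt0r_neq0 (alpha_gt0 0)).
have blk k n : p (k * N.+1 + n)%N = gamma ^+ k * p n.
  exact: null_seq_block alpha_per beta_per monodromy k n.
have rec n : alpha n%:Z * p n + beta n.+1%:Z * p n.+1 + alpha n.+1%:Z * p n.+2 = 0.
  exact: null_seq_rec (lt0r_neq0 (alpha_gt0 _)).
have pN : p N = 0.
  exact: null_seq_block_end alpha_per beta_per alpha_gt0 monodromy.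
have step k i : (i < N)%N ->
    a (k * N.+1 + i)%N * p (k * N.+1 + i)%N
    + b (k * N.+1 + i.+1)%N * p (k * N.+1 + i.+1)%N
    + a (k * N.+1 + i.+1)%N * p (k * N.+1 + i.+2)%N = 0.
  move=> iN; rewrite !blk !ha ?hb ?ltnS // 1?ltnW //.
  by rewrite -[RHS](mulr0 (ta k * gamma ^+ k)) -(rec i); ring.
have border k :
    b (k * N.+1 + 0)%N * p (k * N.+1 + 0)%N
    + a (k * N.+1 + 0)%N * p (k * N.+1 + 0).+1 = 0.
  rewrite -addnS !blk ha // hb //.
  by rewrite -[RHS](mulr0 (ta k * gamma ^+ k)) -start; ring.
case=> [|m] /=.
  rewrite -!rmorphM -rmorphD /=; have := border 0%N.
  by rewrite mul0n !add0n => ->.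
rewrite -!rmorphM -!rmorphD /=.
rewrite [m](divn_eq m N.+1); set k := (m %/ _)%N.
have := ltn_pmod m (ltn0Sn N); set i := (m %% _)%N => iN1.
case: (ltnP i N) => [iN|Ni].
  by have := step k i iN; rewrite !addnS => ->.
have {iN1 Ni} -> : i = N by apply/eqP; rewrite eqn_leq -ltnS iN1.
rewrite [p (k * N.+1 + N)%N]blk pN !mulr0 add0r.
have -> : (k * N.+1 + N).+1 = (k.+1 * N.+1 + 0)%N by rewrite mulSn addn0 addnC addSn.
by rewrite border.
Qed.

(** The terms at the multiples of N have modulus 1. *)
Lemma null_seq_not_ell2 (R : realType) (N : nat) (alpha beta : int -> R)
    (gamma : R) :
  (0 < N)%N ->
  seq_periodic N alpha -> seq_periodic N beta ->
  rev_prod_mx (transfer_mx alpha beta) 1 N = gamma%:M -> `|gamma| = 1 ->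
  ~ cvgn (series (fun n => null_seq alpha beta n ^+ 2)).
Proof.
move=> N_gt0 alpha_per beta_per monodromy gamma1 /cvg_series_cvg_0.
move=> /cvgrPdist_lt/(_ _ ltr01)[M _ /(_ (M * N + 0)%N)] /=.
rewrite addn0 leq_pmulr // => /(_ isT); rewrite -[(M * N)%N]addn0.
rewrite (null_seq_block alpha_per beta_per monodromy) null_seq0 mulr1.
by rewrite sub0r normrN -exprM normrX gamma1 expr1n ltxx.
Qed.

Theorem theoremA (R : realType) (N : nat) (alpha beta : int -> R)
    (ta a b : nat -> R)
    (hN : (0 < N)%N)
    (alpha_per : seq_periodic N alpha) (beta_per : seq_periodic N beta)
    (alpha_gt0 : forall n : int, 0 < alpha n)
    (ta_gt0 : forall k : nat, 0 < ta k)
    (hprod : exists2 gamma : R, `|gamma| = 1 &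
       rev_prod_mx (transfer_mx alpha beta) 1%N N = gamma%:M)
    (ha : forall k i : nat, (i < N)%N -> a (k * N + i)%N = alpha i%:Z * ta k)
    (hb : forall k i : nat, (i < N)%N -> b (k * N + i)%N = beta i%:Z * ta k) :
  self_adjoint (jacobi_operator a b) /\
  ~ point_spectrum (jacobi_operator a b) 0.
Proof.
case: hprod => gamma gamma1 monodromy.
have p0 := null_seq0 alpha beta.
have divp := null_seq_not_ell2 hN alpha_per beta_per monodromy gamma1.
have Jp := jacobi_null_seq hN alpha_per beta_per alpha_gt0 monodromy ha hb.
split; first exact: jacobi_self_adjoint p0 divp Jp.
apply: zero_notin_point_spectrum p0 divp Jp => n.
by rewrite (divn_eq n N) ha ?ltn_pmod // mulf_neq0 // lt0r_neq0.
Qed.
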